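(* Let $D=(V,E)$ be a network with source $s$, sink $t$ and non-negative capacities $c$, let $f$ be a maximum flow in $D$, and let $\mathcal{B}=\mathcal{B}_f$ be the set of vertex sets of the strongly connected components of the residual network $D_f$. Let $A$, $C$, $R$ be the sets of essential, dummy I and dummy II edges of $D$, respectively. Then: (1) $A=\{e\in E \mid f(e)>0,\ \alpha(e)\setminus B\neq\emptyset \text{ for all } B\in\mathcal{B}\}$; (2) $C=\{e\in E \mid \text{there exists } B\in\mathcal{B} \text{ with } \alpha(e)\subseteq B\}$; (3) $R=\{e\in E \mid f(e)=0,\ \alpha(e)\setminus B\neq\emptyset \text{ for all } B\in\mathcal{B}\}$.
   Context: A network $D=(V,E)$ is a finite directed graph with distinct vertices $s$ (source) and $t$ (sink) and a non-negative capacity $c(e)\ge 0$ for each edge $e\in E$. A flow is a map $f:E\to\mathbb{R}$ with $0\le f(e)\le c(e)$ for all $e\in E$ and $\sum_{(u,v)\in E}f(u,v)=\sum_{(v,u)\in E}f(v,u)$ for every $v\in V\setminus\{s,t\}$ (flow into $v$ equals flow out of $v$). Its value is $|f|=\sum_{(s,v)\in E}f(s,v)-\sum_{(v,s)\in E}f(v,s)$. A maximum flow is a flow of maximum value. An edge $e\in E$ is essential if $f(e)=c(e)$ for all maximum flows $f$, and is called dummy otherwise; it is dummy I if there is a maximum flow $f$ with $0<f(e)<c(e)$; it is dummy II if $f(e)=0$ for all maximum flows $f$. For a flow $f$, the residual network is the directed graph $D_f=(V,E_f)$ consisting of the unsaturated forward edges and the nonempty backward edges: $(u,v)\in E_f$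 iff either $(u,v)\in E$ and $f(u,v)<c(u,v)$, or $(v,u)\in E$ and $f(v,u)>0$. A strongly connected component is a maximal subgraph in which there is a directed path between every pair of vertices. (The set $\mathcal{B}_f$ does not depend on the choice of the maximum flow $f$.) $\alpha(e)$ denotes the set of endpoints of the edge $e$.
   Formalization: The three identities are asserted only for edges of positive capacity: an edge with c(e)=0 is essential by definition but has f(e)=0, so (1) as stated fails for it; zero-capacity edges may still occur in the network. *)

(* Defs.v *)
From mathcomp Require Import all_boot all_order all_algebra.
From mathcomp Require Import boolp classical_sets.

Set Implicit Arguments.
Unset Strict Implicit.
Unset Printing Implicit Defensive.

Import Order.TTheory GRing.Theory Num.Theory.

Local Open Scope ring_scope.

(* Antiparallel edges and loops are allowed.  Capacities and flows are total functions on V * V, but only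
   their values on [edges] are ever used. *)
Record network (R : realFieldType) (V : finType) := Network {
  edges : {set V * V};
  source : V;
  sink : V;
  cap : V * V -> R;
  source_neq_sink : source != sink;
  cap_ge0 : forall e, e \in edges -> 0 <= cap e
}.

Section Networks.
Variables (R : realFieldType) (V : finType) (D : network R V).
Implicit Types (f : V * V -> R) (e : V * V).

Definition is_flow f : Prop :=
  (forall e, e \in edges D -> 0 <= f e <= cap D e) /\
  (forall v, v != source D -> v != sink D ->
     \sum_(u | (u, v) \in edges D) f (u, v)
     = \sum_(u | (v, u) \in edges D) f (v, u)).

Definition flow_value f : R :=
  \sum_(v | (source D, v) \in edges D) f (source D, v)
  - \sum_(v | (v, source D) \in edges D) f (v, source D).

Definition is_max_flow f : Prop :=
  is_flow f /\ forall g, is_flow g -> flow_value g <= flow_value f.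

Definition essential e : Prop :=
  e \in edges D /\ forall f, is_max_flow f -> f e = cap D e.

Definition dummy e : Prop := e \in edges D /\ ~ essential e.

Definition essential_edges : set (V * V) := [set e | essential e]%classic.

Definition dummyI_edges : set (V * V) :=
  [set e | dummy e /\ exists2 f, is_max_flow f & 0 < f e < cap D e]%classic.

Definition dummyII_edges : set (V * V) :=
  [set e | dummy e /\ forall f, is_max_flow f -> f e = 0]%classic.

(* An edge of capacity 0 is essential although it carries no flow, whatever the
   components containing its endpoints: characterisations of essential, dummy I
   and dummy II edges in terms of a maximum flow and the components of its
   residual network can hold only on edges of positive capacity. *)
Definition positive_edges : set (V * V) :=
  [set e | e \in edges D /\ 0 < cap D e]%classic.

Definition residual f : rel V := fun u v =>
  ((u, v) \in edges D) && (f (u, v) < cap D (u, v))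
  || ((v, u) \in edges D) && (0 < f (v, u)).

End Networks.

Section Components.
Variable V : finType.

(* Paths are required to stay inside B; a path may be empty, so that singletons
   are strongly connected. *)
Definition strongly_connected (r : rel V) (B : {set V}) : bool :=
  [forall x in B, forall y in B, connect [rel a b in B | r a b] x y].

Definition scc (r : rel V) : {set {set V}} :=
  [set B | maxset (strongly_connected r) B]%SET.

Definition endpoints (e : V * V) : {set V} := [set e.1; e.2]%SET.

End Components.

(* Main.v *)
(* The difference of two maximum flows is a circulation whose positive part
   uses unsaturated edges and whose negative part uses edges carrying flow.
   Balancing it on the set of vertices reachable in the residual network from
   one endpoint of an edge on which the two flows differ shows that both
   endpoints lie in the same component.  Conversely, an edge inside a component
   lies on a closed walk of the residual network, and a small push along that
   walk makes the flow on this edge strictly intermediate. *)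
Require Import Defs.
From mathcomp Require Import all_boot all_order all_algebra.
From mathcomp Require Import boolp classical_sets.
From mathcomp Require Import lra.

Set Implicit Arguments.
Unset Strict Implicit.
Unset Printing Implicit Defensive.

Import Order.TTheory GRing.Theory Num.Theory.

Local Open Scope ring_scope.

(** * Strong components and mutual reachability *)

Section Scc.
Variables (V : finType) (r : rel V).

Lemma strongly_connected_connect (B : {set V}) x y :
  strongly_connected r B -> x \in B -> y \in B -> connect r x y.
Proof.
move=> /forall_inP scB xB yB.
have /forall_inP/(_ y yB) := scB x xB.
by apply: connect_sub => a b /andP[_ rab]; apply: connect1.
Qed.

(** Every vertex on a path from [y] to [z] is reached from [x] through [y] and reaches [x] through
    [z], so the path never leaves the class. *)
Lemma strongly_connected_class x :
  strongly_connected r [set y | connect r x y && connect r y x]%SET.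
Proof.
set B := [set y | _]%SET.
apply/forall_inP => y yB; apply/forall_inP => z zB.
have [_ zx] : connect r x z /\ connect r z x by move: zB; rewrite inE => /andP.
have [xy _] : connect r x y /\ connect r y x by move: yB; rewrite inE => /andP.
have /connectP[p rp zE] : connect r y z.
  move: yB zB; rewrite !inE => /andP[_ yx] /andP[xz _].
  exact: connect_trans xz.
elim: p y yB xy rp zE => [|a p IHp] y yB xy /= => [_ ->|/andP[rya rp] zE].
  exact: connect0.
have xa : connect r x a := connect_trans xy (connect1 rya).
have aB : a \in B.
  rewrite inE xa /=; apply: connect_trans zx.
  by apply/connectP; exists p.
by apply: connect_trans (IHp a aB xa rp zE); apply: connect1; rewrite /= yB aB.
Qed.

(** Turns components into reachability, the form used by the flow arguments. Any maximal strongly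
    connected set extending the class of [e.1] is a witness. *)
Lemma scc_endpointsP (e : V * V) :
  reflect (exists2 B, B \in scc r & endpoints e \subset B)
          (connect r e.1 e.2 && connect r e.2 e.1).
Proof.
apply: (iffP idP) => [e12|[B]].
  have [B maxB sB] := maxset_exists (strongly_connected_class e.1).
  exists B; first by rewrite inE.
  apply: fintype.subset_trans sB.
  by rewrite finset.subUset !finset.sub1set !inE connect0 e12.
rewrite inE finset.subUset !finset.sub1set => /maxsetp scB /andP[e1B e2B].
by rewrite !(strongly_connected_connect scB).
Qed.

Lemma scc_endpointsPn (e : V * V) :
  (forall B, B \in scc r -> (endpoints e :\: B)%SET != finset.set0) <->
  ~~ (connect r e.1 e.2 && connect r e.2 e.1).
Proof.
split=> [sepe | /scc_endpointsP sepe B Bscc].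
  by apply/scc_endpointsP => -[B /sepe]; rewrite finset.setD_eq0 => /negP.
by rewrite finset.setD_eq0; apply/negP => sB; apply: sepe; exists B.
Qed.

End Scc.

(** Since each [P i] holds on a whole interval above 0, the minimum of finitely many bounds serves
    all [i]. *)
Lemma common_step (R : realFieldType) (I : finType) (P : I -> R -> Prop) :
  (forall i, exists2 d, 0 < d & forall t, 0 < t <= d -> P i t) ->
  exists2 d, 0 < d & forall i, P i d.
Proof.
move=> step.
suff [d d0 Pd] : exists2 d, 0 < d &
    forall i t, i \in enum I -> 0 < t <= d -> P i t.
  by exists d => // i; apply: Pd; rewrite ?mem_enum ?d0 ?lexx.
elim: (enum I) => [|i s [d d0 Pd]]; first by exists 1.
have [d' d'0 Pd'] := step i.
exists (Num.min d d'); first by rewrite lt_min d0.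
move=> j t; rewrite inE le_min => /orP[/eqP->|js] /and3P[t0 td td'].
  by apply: Pd'; rewrite t0.
by apply: Pd => //; rewrite t0.
Qed.

(** * Divergence, and circulations compatible with a flow *)

Section Divergence.
Variables (R : realFieldType) (V : finType) (D : network R V).
Implicit Types (f g h : V * V -> R) (e : V * V) (S : {set V}).

(** Net outflow at [v], as one sum over edges: summing over vertices becomes an exchange of sums,
    and loops cancel. *)
Definition divergence h v : R :=
  \sum_(e in edges D) h e * ((e.1 == v)%:R - (e.2 == v)%:R).

Lemma divergenceE h v : divergence h v =
  \sum_(u | (v, u) \in edges D) h (v, u)
  - \sum_(u | (u, v) \in edges D) h (u, v).
Proof.
rewrite /divergence; under eq_bigr do rewrite mulrBr.
rewrite sumrB; congr (_ - _).
- rewrite (eq_bigr (fun e => if e.1 == v then h e else 0)); last first.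
    by move=> e _; case: eqP; rewrite ?mulr1 ?mulr0.
  rewrite -big_mkcondr (reindex_onto (pair v) snd) /=; last first.
    by move=> [a b] /andP[_ /= /eqP->].
  by apply: eq_bigl => u; rewrite !eqxx !andbT.
- rewrite (eq_bigr (fun e => if e.2 == v then h e else 0)); last first.
    by move=> e _; case: eqP; rewrite ?mulr1 ?mulr0.
  rewrite -big_mkcondr (reindex_onto (pair^~ v) fst) /=; last first.
    by move=> [a b] /andP[_ /= /eqP->].
  by apply: eq_bigl => u; rewrite !eqxx !andbT.
Qed.

Lemma divergenceD g h v :
  divergence (fun e => g e + h e) v = divergence g v + divergence h v.
Proof. by rewrite -big_split; apply: eq_bigr => e _; rewrite mulrDl. Qed.

Lemma divergenceZ a h v :
  divergence (fun e => a * h e) v = a * divergence h v.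
Proof. by rewrite big_distrr; apply: eq_bigr => e _; rewrite /= mulrA. Qed.

Lemma divergence_delta e v : e \in edges D ->
  divergence (fun e' => (e' == e)%:R) v = (e.1 == v)%:R - (e.2 == v)%:R.
Proof.
move=> eE; rewrite /divergence (bigD1 e) //= eqxx mul1r big1 ?addr0 //.
by move=> e' /andP[_ /negPf->]; rewrite mul0r.
Qed.

Lemma sum_mem_eq S x : \sum_(v in S) (x == v)%:R = (x \in S)%:R :> R.
Proof.
case: (boolP (x \in S)) => xS.
  rewrite (bigD1 x) //= eqxx big1 ?addr0 // => v /andP[_].
  by rewrite eq_sym => /negPf->.
by rewrite big1 // => v vS; case: eqP => // xv; rewrite xv vS in xS.
Qed.

Lemma sum_divergence h S : \sum_(v in S) divergence h v =
  \sum_(e in edges D) h e * ((e.1 \in S)%:R - (e.2 \in S)%:R).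
Proof.
rewrite exchange_big; apply: eq_bigr => e _ /=.
by rewrite -big_distrr sumrB !sum_mem_eq.
Qed.

Lemma sum_divergence_all h : \sum_v divergence h v = 0.
Proof.
have := sum_divergence h [set: V].
under eq_bigl do rewrite inE.
by move=> ->; rewrite big1 // => e _; rewrite !inE subrr mulr0.
Qed.

Lemma flow_valueE f : flow_value D f = divergence f (source D).
Proof. by rewrite divergenceE. Qed.

Lemma is_flowP f : is_flow D f <->
  (forall e, e \in edges D -> 0 <= f e <= cap D e) /\
  (forall v, v != source D -> v != sink D -> divergence f v = 0).
Proof.
split=> -[capf consf]; split=> // v vs vt; have := consf v vs vt.
  by move=> eqf; rewrite divergenceE eqf subrr.
by rewrite divergenceE => /subr0_eq.
Qed.

Lemma eq_flow_value_divergence f g v : is_flow D f -> is_flow D g ->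
  flow_value D f = flow_value D g -> divergence f v = divergence g v.
Proof.
move=> /is_flowP[_ consf] /is_flowP[_ consg]; rewrite !flow_valueE => eqs.
have eqE w : w != sink D -> divergence f w = divergence g w.
  by move=> wt; have [->//|ws] := eqVneq w (source D); rewrite consf ?consg.
have [->|/eqE//] := eqVneq v (sink D).
(* Divergences sum to 0 over all vertices, so the other vertices determine the value at the sink. *)
have := etrans (sum_divergence_all f) (esym (sum_divergence_all g)).
rewrite (bigD1 (sink D)) //= [RHS](bigD1 (sink D)) //=.
by rewrite (eq_bigr _ eqE) => /addIr.
Qed.

(** The feasible directions at [f]: a small enough positive multiple of [h] can be added within the
    capacities. *)
Definition residual_compatible f h := forall e, e \in edges D ->
  (0 < h e -> f e < cap D e) /\ (h e < 0 -> 0 < f e).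

(* No term of the balance over the set of vertices reachable from x is
   positive, so none is negative. *)
Lemma compatible_balance f h x e :
  (forall v, divergence h v = 0) -> residual_compatible f h ->
  e \in edges D ->
  let S := [set y | connect (residual D f) x y]%SET in
  h e * ((e.1 \in S)%:R - (e.2 \in S)%:R) = 0.
Proof.
move=> div0 comp eE S; move: e eE.
have S_closed a b : a \in S -> residual D f a b -> b \in S.
  by rewrite !inE => xa ab; apply: connect_trans xa (connect1 ab).
have term_le0 e : e \in edges D ->
    h e * ((e.1 \in S)%:R - (e.2 \in S)%:R) <= 0.
  case: e => a b eE /=; have [pos neg] := comp _ eE.
  (* A positive term would give a residual arc leaving [S]: [e] itself if it exits [S], its reversal
     if it enters. *)
  case aS: (a \in S); case bS: (b \in S); rewrite ?subrr ?mulr0 //.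
    rewrite subr0 mulr1 leNgt; apply/negP => /pos fc.
    by rewrite (S_closed a b) // /residual eE fc in bS.
  rewrite sub0r mulrN1 oppr_le0 leNgt; apply/negP => /neg f0.
  by rewrite (S_closed b a) // /residual eE f0 orbT in aS.
have := sum_divergence h S; rewrite big1 => [sum0|v _]; last exact: div0.
move=> e eE; apply/eqP; rewrite -oppr_eq0; apply/eqP; move: e eE.
apply: psumr_eq0P => [e eE|]; first by rewrite oppr_ge0 term_le0.
by rewrite sumrN -sum0 oppr0.
Qed.

Lemma compatible_connect f h e :
  (forall v, divergence h v = 0) -> residual_compatible f h ->
  e \in edges D -> h e != 0 ->
  connect (residual D f) e.1 e.2 && connect (residual D f) e.2 e.1.
Proof.
move=> div0 comp eE he0.
(* As [h e] is nonzero, balance puts both endpoints or neither in the set reachable from [x]; it is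
   then applied at both endpoints. *)
have bal x : connect (residual D f) x e.1 = connect (residual D f) x e.2.
  move/eqP: (compatible_balance x div0 comp eE).
  rewrite mulf_eq0 (negPf he0) /= !inE subr_eq0.
  by rewrite eqr_nat; case: (connect _ x e.1); case: (connect _ x e.2).
by rewrite -bal connect0 bal connect0.
Qed.

Lemma max_flows_differ_connect f g e :
  is_max_flow D f -> is_max_flow D g -> e \in edges D -> g e != f e ->
  connect (residual D f) e.1 e.2 && connect (residual D f) e.2 e.1.
Proof.
move=> [flf maxf] [flg maxg] eE gfe.
apply: (@compatible_connect f (fun e => g e + -1 * f e)) => //.
- move=> v; rewrite divergenceD divergenceZ.
  rewrite (@eq_flow_value_divergence f g) ?mulN1r ?subrr //.
  by apply/eqP; rewrite eq_le maxf ?maxg.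
- move=> e' e'E; have [/(_ _ e'E) + _] := flf; have [/(_ _ e'E) + _] := flg.
  by move=> /andP[? ?] /andP[? ?]; split=> ?; lra.
- by rewrite mulN1r subr_eq0.
Qed.

(** * Pushing flow along residual walks *)

Lemma compatibleD f g h : residual_compatible f g -> residual_compatible f h ->
  residual_compatible f (fun e => g e + h e).
Proof.
move=> cg ch e eE; have [g1 g2] := cg e eE; have [h1 h2] := ch e eE.
split=> gh.
  by case: (ltP 0 (g e)) => [/g1//|g0]; apply: h1; lra.
by case: (ltP (g e) 0) => [/g2//|g0]; apply: h2; lra.
Qed.

Lemma compatible_delta f e : e \in edges D -> f e < cap D e ->
  residual_compatible f (fun e' => (e' == e)%:R).
Proof.
move=> eE fe e' _; case: eqP => [->|_]; split=> //; by rewrite ?ltxx ?ltr10.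
Qed.

Lemma compatible_opp_delta f e : e \in edges D -> 0 < f e ->
  residual_compatible f (fun e' => -1 * (e' == e)%:R).
Proof.
move=> eE fe e' _; case: eqP => [->|_]; split=> //; rewrite ?mulr0 ?ltxx //.
by rewrite mulr1 oppr_gt0 ltr10.
Qed.

Lemma residual_push f a b : residual D f a b -> exists2 g,
  residual_compatible f g & forall v, divergence g v = (a == v)%:R - (b == v)%:R.
Proof.
case/orP => /andP[eE fe].
  by exists (fun e => (e == (a, b))%:R) => [|v];
    [apply: compatible_delta | rewrite divergence_delta].
exists (fun e => -1 * (e == (b, a))%:R) => [|v].
  exact: compatible_opp_delta.
by rewrite divergenceZ divergence_delta //= mulN1r opprB.
Qed.

(** Unit pushes along the arcs of a path are added up: compatibility is preserved by sums and the
    divergences telescope. *)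
Lemma connect_push f a b : connect (residual D f) a b -> exists2 g,
  residual_compatible f g & forall v, divergence g v = (a == v)%:R - (b == v)%:R.
Proof.
case/connectP => p; elim: p a => [|c p IHp] a /= => [_ ->|].
  exists (fun=> 0) => [e _|v]; first by rewrite ltxx.
  by rewrite /divergence big1 ?subrr // => e _; rewrite mul0r.
case/andP => /residual_push[g cg dg] /IHp{}IHp /IHp[h ch dh].
exists (fun e => g e + h e) => [|v].
  exact: compatibleD.
by rewrite divergenceD dg dh addrA subrK.
Qed.

Lemma compatible_step f g :
  (forall e, e \in edges D -> 0 <= f e <= cap D e) ->
  residual_compatible f g ->
  exists2 t, 0 < t & forall e, e \in edges D -> 0 <= f e + t * g e <= cap D e.
Proof.
move=> capf comp.
apply: (@common_step _ _
  (fun e t => e \in edges D -> 0 <= f e + t * g e <= cap D e)) => e.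
have [eE|_] := boolP (e \in edges D); last by exists 1.
have /andP[f0 fc] := capf e eE; have [pos neg] := comp e eE.
have [g0|g0|->] := ltgtP (g e) 0.
(* Each bound is the room left before 0 or the capacity, divided by the rate of change. *)
- exists (f e / - g e); first by rewrite divr_gt0 ?neg ?oppr_gt0.
  move=> t /andP[t0]; rewrite ler_pdivlMr ?oppr_gt0 // => tg _.
  by apply/andP; split; nra.
- exists ((cap D e - f e) / g e); first by rewrite divr_gt0 ?subr_gt0 ?pos.
  move=> t /andP[t0]; rewrite ler_pdivlMr // => tg _.
  by apply/andP; split; nra.
- by exists 1 => // t _ _; rewrite mulr0 addr0 f0.
Qed.

(** Adding a multiple of a circulation changes neither conservation nor value, so a feasible push
    stays maximum. *)
Lemma max_flow_push f g e : is_max_flow D f ->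
  residual_compatible f g -> (forall v, divergence g v = 0) ->
  e \in edges D -> g e != 0 ->
  exists2 f', is_max_flow D f' & 0 < f' e < cap D e.
Proof.
move=> [flf maxf] comp div0 eE ge_neq0.
have /is_flowP[capf consf] := flf.
have [t t0 capt] := compatible_step capf comp.
pose f' e := f e + t / 2 * g e.
have divf' v : divergence f' v = divergence f v.
  by rewrite divergenceD divergenceZ div0 mulr0 addr0.
exists f'.
  split=> [|k /maxf]; last by rewrite !flow_valueE divf'.
  apply/is_flowP; split=> [e' e'E|v vs vt]; last by rewrite divf' consf.
  have /andP[? ?] := capf _ e'E; have /andP[? ?] := capt _ e'E.
  by rewrite /f'; apply/andP; split; lra.
(* f' e is the midpoint of two distinct points of [0, cap e] *)
have /andP[? ?] := capf _ eE; have /andP[? ?] := capt _ eE.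
have : t * g e != 0 by rewrite mulf_neq0 // gt_eqF.
by rewrite /f' neq_lt => /orP[] ?; apply/andP; split; lra.
Qed.

(** If [f e] is 0, push along [e] and back from [e.2] to [e.1]; if [e] is saturated, push along its
    reversal and then from [e.1] to [e.2]; otherwise [f] itself works. *)
Lemma connect_intermediate f e : is_max_flow D f ->
  e \in edges D -> 0 < cap D e ->
  connect (residual D f) e.1 e.2 -> connect (residual D f) e.2 e.1 ->
  exists2 f', is_max_flow D f' & 0 < f' e < cap D e.
Proof.
move=> maxf eE c0 e12 e21.
have capf := maxf.1.1; have /andP[f0 fc] := capf e eE.
have [fe0|fe0] := eqVneq (f e) 0.
  have fltc : f e < cap D e by rewrite fe0.
  have [g cg dg] := connect_push e21.
  apply: (max_flow_push maxf (compatibleD (compatible_delta eE fltc) cg)) => //.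
    by move=> v; rewrite divergenceD divergence_delta // dg addrA subrK subrr.
  (* The return walk cannot cancel the unit on [e]: since [f e = 0], compatibility forces
     [g e >= 0]. *)
  have [_ neg] := cg e eE; rewrite eqxx gt_eqF //.
  by rewrite ltr_pwDl // leNgt; apply/negP => /neg; rewrite fe0 ltxx.
have fgt0 : 0 < f e by rewrite lt_def fe0.
have [fec|fec] := eqVneq (f e) (cap D e); last first.
  by exists f; rewrite // fgt0 lt_def eq_sym fec fc.
have [g cg dg] := connect_push e12.
apply: (max_flow_push maxf (compatibleD (compatible_opp_delta eE fgt0) cg)) => //.
  by move=> v; rewrite divergenceD divergenceZ divergence_delta // dg mulN1r addNr.
have [pos _] := cg e eE; rewrite eqxx mulr1 lt_eqF //.
suff : g e <= 0 by lra.
by rewrite leNgt; apply/negP => /pos; rewrite fec ltxx.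
Qed.

Lemma dummyI_edgeP f e : is_max_flow D f -> e \in edges D -> 0 < cap D e ->
  (exists2 f', is_max_flow D f' & 0 < f' e < cap D e) <->
  connect (residual D f) e.1 e.2 && connect (residual D f) e.2 e.1.
Proof.
move=> maxf eE c0; split=> [[g maxg /andP[g0 gc]]|/andP[]]; last first.
  exact: connect_intermediate.
(* If [g] agrees with [f] on [e], then [f e] is intermediate and both arcs between the endpoints are
   residual. *)
have [gf|] := eqVneq (g e) (f e); last exact: max_flows_differ_connect.
case: e eE {c0} g0 gc gf => a b eE g0 gc gf /=.
by rewrite !connect1 // /residual eE -gf ?g0 ?gc ?orbT.
Qed.

End Divergence.

Theorem theorem3p3 (R : realFieldType) (V : finType) (D : network R V)
    (f : V * V -> R) (f_max : is_max_flow D f) :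
  let BB := scc (residual D f) in
  let P := positive_edges D in
  [/\ (essential_edges D `&` P =
        [set e | [/\ e \in edges D, (0 < f e)%R &
           forall B, B \in BB -> (endpoints e :\: B)%SET != finset.set0]] `&` P)%classic,
      (dummyI_edges D `&` P =
        [set e | e \in edges D /\
           exists2 B, B \in BB & endpoints e \subset B] `&` P)%classic
    & (dummyII_edges D `&` P =
        [set e | [/\ e \in edges D, f e = 0%R &
           forall B, B \in BB -> (endpoints e :\: B)%SET != finset.set0]] `&` P)%classic].
Proof.
have capf := f_max.1.1.
have same g e : is_max_flow D g -> e \in edges D ->
    ~~ (connect (residual D f) e.1 e.2 && connect (residual D f) e.2 e.1) ->
    g e = f e.
  move=> maxg eE; apply: contraNeq; exact: max_flows_differ_connect.
move=> BB P; split; apply/seteqP; split=> e [] /=.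
- move=> [eE ess] [_ c0]; split=> //; split=> //; first by rewrite ess.
  apply/scc_endpointsPn/negP => /(dummyI_edgeP f_max eE c0)[g /ess->].
  by rewrite ltxx andbF.
- move=> [eE f0 /scc_endpointsPn sep] [_ c0]; do 2!split=> //.
  (* Were [f e] below capacity, [f] itself would be intermediate on [e] and connect its endpoints
     both ways. *)
  move=> g maxg; rewrite (same g) //; apply/eqP; rewrite eq_le.
  have /andP[_ ->] := capf e eE; rewrite leNgt; apply/negP => fc.
  by case/negP: sep; apply/dummyI_edgeP => //; exists f; rewrite ?f0.
- move=> [[eE _] inter] [_ c0]; do 2!split=> //.
  by apply/scc_endpointsP; apply/dummyI_edgeP.
- move=> [eE /scc_endpointsP con] [_ c0]; do 2!split=> //.
    split=> // -[_ ess]; have [g /ess ->] := (dummyI_edgeP f_max eE c0).2 con.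
    by rewrite ltxx andbF.
  by apply/(dummyI_edgeP f_max).
- move=> [[eE _] zero] [_ c0]; split=> //; split=> //; first exact: zero.
  apply/scc_endpointsPn/negP => /(dummyI_edgeP f_max eE c0)[g /zero->].
  by rewrite ltxx.
- move=> [eE f0 /scc_endpointsPn sep] [_ c0]; split=> //; split.
    (* [f] itself shows that [e] is not essential, as [f e = 0] lies below the positive capacity. *)
    by split=> // -[_ /(_ f f_max)]; rewrite f0 => c0'; rewrite -c0' ltxx in c0.
  by move=> g maxg; rewrite (same g).
Qed.
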